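(* Let $\{ \lambda_n \} \subset (0, + \infty)$ be an increasing unbounded sequence. Let also a sequence $\{ (x_n, p_n) \} \subset A \times [0, +\infty)$ be such that $$F_{\lambda_n}(x_n, p_n) \le \inf_{(x, p) \in A \times \mathbb{R}_+} F_{\lambda_n}(x, p) + \varepsilon \quad \forall n \in \mathbb{N}$$ for some $\varepsilon > 0$, where $F_\lambda$ is the singular penalty function. Then $p_n \to 0$ and $d(0, G(x_n)) \to 0$ as $n \to \infty$. Moreover, if, additionally, the zero duality gap property holds true for $F_{\lambda}$, then $f^* \le \liminf_{n \to \infty} f(x_n) \le \limsup_{n \to \infty} f(x_n) \le f^* + \varepsilon$.
   Context: Setting. $X$ is a metric space, $Y$ a normed space, $A \subset X$ nonempty, $f \colon X \to \mathbb{R} \cup \{+\infty\}$, and $G \colon X \rightrightarrows Y$ a set-valued mapping with closed values. The problem $(\mathcal{P})$ is: minimize $f(x)$ subject to $0 \in G(x)$, $x \in A$; its feasible set is $\Omega = \{x \in A : 0 \in G(x)\}$. It is assumed that $f$ attains a global minimum on $\Omega$, with finite value $f^*$. $\mathbb{R}_+ = [0,+\infty)$. Singular penalty function. Fix $w \in Y$ and non-decreasing functions $\phi \colon [0, +\infty] \to [0, +\infty]$, $\omega \colon \mathbb{R}_+ \to [0, +\infty]$ such that $\phi(t) = 0$ iff $t = 0$ and $\omega(t) = 0$ iff $t = 0$. For $(x,p) \in X \times \mathbb{R}_+$ put $\varphi(x,p) = 0$ if $x \in \Omega$, $p = 0$; $\varphi(x,p) = +\infty$ if $x \notin \Omega$,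 $p = 0$; and $\varphi(x,p) = p^{-1} \phi( d(0, G(x) - p w)^2 ) + \omega(p)$ if $p > 0$, where $d(0, G(x) - pw) = \inf_{y \in G(x)} \|y - pw\|$ if $G(x) \neq \emptyset$, and $= +\infty$ if $G(x) = \emptyset$. The singular penalty function is $F_\lambda(x,p) = f(x) + \lambda \varphi(x,p)$, $\lambda \ge 0$. The zero duality gap property for $F_\lambda$ means $\sup_{\lambda \ge 0} \inf_{(x, p) \in A \times \mathbb{R}_+} F_{\lambda}(x, p) = \inf_{x \in \Omega} f(x)$. *)

(* Defs.v *)
From HB Require Import structures.
From mathcomp Require Import all_boot all_order all_algebra.
From mathcomp Require Import all_classical all_reals all_analysis.
Import Order.TTheory GRing.Theory Num.Theory.
Import numFieldNormedType.Exports.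

Set Implicit Arguments.
Unset Strict Implicit.
Unset Printing Implicit Defensive.

Local Open Scope classical_set_scope.
Local Open Scope ring_scope.
Local Open Scope ereal_scope.

(* d(0, S); since [ereal_inf set0 = +oo], it is +oo when S is empty. *)
Definition dist0 (R : realType) (Y : normedModType R) (S : set Y) : \bar R :=
  ereal_inf [set `|y|%:E | y in S].

Definition feasible (R : realType) (X : Type) (Y : normedModType R)
    (A : set X) (G : X -> set Y) : set X :=
  [set x | A x /\ G x 0%R].

Definition nonneg_real (R : realType) : set R := [set p : R | (0 <= p)%R].

(* [phi] and [omega] are total functions, but only their values on [0, +oo]
   and [0, +oo[ matter, and likewise [varphi] is only meaningful for p >= 0. *)
Definition varphi (R : realType) (X : Type) (Y : normedModType R)
    (A : set X) (G : X -> set Y) (w : Y)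
    (phi : \bar R -> \bar R) (omega : R -> \bar R) (x : X) (p : R) : \bar R :=
  if p == 0%R then (if x \in feasible A G then 0 else +oo)
  else (p^-1)%:E * phi (dist0 [set (y - p *: w)%R | y in G x] ^+ 2) + omega p.

(* In [\bar R], [0 * +oo = 0], so that [F 0 = f]. *)
Definition singular_penalty (R : realType) (X : Type) (Y : normedModType R)
    (f : X -> \bar R) (A : set X) (G : X -> set Y) (w : Y)
    (phi : \bar R -> \bar R) (omega : R -> \bar R)
    (lambda : R) (x : X) (p : R) : \bar R :=
  f x + lambda%:E * varphi A G w phi omega x p.

Definition inf_penalty (R : realType) (X : Type) (A : set X)
    (F : R -> X -> R -> \bar R) (lambda : R) : \bar R :=
  ereal_inf [set F lambda z.1 z.2 | z in A `*` @nonneg_real R].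

Definition zero_duality_gap (R : realType) (X : Type) (Y : normedModType R)
    (f : X -> \bar R) (A : set X) (G : X -> set Y)
    (F : R -> X -> R -> \bar R) : Prop :=
  ereal_sup [set inf_penalty A F lambda | lambda in @nonneg_real R]
  = ereal_inf [set f x | x in feasible A G].

(* Main.v *)
Require Import Defs.
From HB Require Import structures.
From mathcomp Require Import all_boot all_order all_algebra.
From mathcomp Require Import all_classical all_reals all_analysis.
From mathcomp Require Import lra.
Import Order.TTheory GRing.Theory Num.Theory.
Import numFieldNormedType.Exports.
Local Open Scope classical_set_scope.
Local Open Scope ring_scope.
Local Open Scope ereal_scope.

(** With v_n := varphi(x_n, p_n) and m := inf F_{lambda_0}, one has
    f^* + eps >= F_{lambda_n}(x_n, p_n) >= m + (lambda_n - lambda_0) v_n; here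
    m is finite because F never takes the value -oo.  Hence v_n -> 0.  As
    omega(p_n) <= v_n and phi(d(0, G(x_n) - p_n w)^2) <= p_n v_n when p_n > 0,
    monotonicity of omega and phi gives p_n -> 0 and d(0, G(x_n)) -> 0.
    Finally f(x_n) + lambda v_n >= inf F_lambda for each fixed lambda, so
    liminf f(x_n) >= sup_lambda inf F_lambda = f^*. *)

Lemma limn_esup_le_near (R : realType) (u : nat -> \bar R) (l : \bar R) :
  (\forall n \near \oo, u n <= l) -> limn_esup u <= l.
Proof.
move=> ul; rewrite limn_esup_lim; apply: lime_le; first exact: is_cvg_esups.
case: ul => N _ ul; exists N => // n /= Nn.
by apply: ge_ereal_sup => _ [k /= nk <-]; apply: ul; exact: leq_trans nk.
Qed.

Lemma limn_einf_ge_near (R : realType) (u : nat -> \bar R) (l : \bar R) :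
  (\forall n \near \oo, l <= u n) -> l <= limn_einf u.
Proof.
move=> ul; rewrite /limn_einf leeNr; apply: limn_esup_le_near.
by apply: filterS ul => n /=; rewrite leeN2.
Qed.

Lemma nneg_near_le_cvg0 (R : realType) (u : nat -> \bar R) :
  (forall n, 0 <= u n) ->
  (forall e : R, (0 < e)%R -> \forall n \near \oo, u n <= e%:E) ->
  u n @[n --> \oo] --> (0 : \bar R).
Proof.
move=> u0 ue; apply/fine_cvgP; split.
  (* Convergence to a real is tested on [fine], so the bound with [e = 1] first makes [u n]
     eventually finite. *)
  apply: filterS (ue 1%R ltr01) => n un.
  by rewrite ge0_fin_numE// (le_lt_trans un) ?ltry.
apply/cvgrPdist_le => e e0; apply: filterS (ue e e0) => n /= un.
rewrite sub0r normrN ger0_norm ?fine_ge0//.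
by rewrite -lee_fin fineK// ge0_fin_numE// (le_lt_trans un) ?ltry.
Qed.

Lemma unbounded_near_ge (R : realType) (lam : nat -> R) :
  (forall m n, (m < n)%N -> (lam m < lam n)%R) -> ~ has_ubound (range lam) ->
  forall M : R, \forall n \near \oo, (M <= lam n)%R.
Proof.
move=> incr nub M.
have [N MN] : exists N, (M <= lam N)%R.
  apply: contrapT => /forallNP MN; apply: nub; exists M => _ [n _ <-].
  by have /negP := MN n; rewrite -ltNge => /ltW.
exists N => // n /=; rewrite leq_eqVlt => /predU1P[<-//|/incr /ltW].
exact: le_trans.
Qed.

(** Subtracting the lower bound at [lam 0] from the upper bound at [lam n] leaves (lam n - lam 0)
    v(z n) <= C - m, whose coefficient tends to infinity. *)
Lemma penalty_term_vanishes (R : realType) (T : Type) (S : set T)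
    (g v : T -> \bar R) (lam : nat -> R) (z : nat -> T) (m C : R) :
  (forall t, g t != -oo) -> (forall t, S t -> 0 <= v t) ->
  (forall n, (0 < lam n)%R) ->
  (forall M : R, \forall n \near \oo, (M <= lam n)%R) ->
  (forall t, S t -> m%:E <= g t + (lam 0%N)%:E * v t) ->
  (forall n, S (z n)) ->
  (forall n, g (z n) + (lam n)%:E * v (z n) <= C%:E) ->
  forall e : R, (0 < e)%R -> \forall n \near \oo, v (z n) <= e%:E.
Proof.
move=> gNy v0 lam0 laminf mg zS gC e e0.
(* Beyond this threshold (lam n - lam 0) e >= |C - m|; the extra 1 keeps [lam n - lam 0] positive,
   so that it can be cancelled even if [C = m]. *)
apply: filterS (laminf (lam 0 + `|C - m| / e + 1)%R) => n lamn.
move: (mg _ (zS n)) (gC n) (gNy (z n)) (v0 _ (zS n)) (lam0 n).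
case: (g (z n)) => [a||]//; case: (v (z n)) => [r||]//.
- rewrite -!EFinM -!EFinD !lee_fin => h1 h2 _ r0 ln.
  have h3 : ((lam n - lam 0) * r <= `|C - m|)%R.
    by apply: le_trans (ler_norm _); lra.
  have h4 : (`|C - m| <= (lam n - lam 0) * e)%R.
    by rewrite -ler_pdivrMr//; lra.
  have h5 : (0 < lam n - lam 0)%R.
    have : (0 <= `|C - m| / e)%R by rewrite divr_ge0// ltW.
    by move: lamn; lra.
  by rewrite -(ler_pM2l h5) (le_trans h3).
(* In the two remaining cases [v (z n)] is [+oo]; as [lam n > 0], the penalized value is [+oo],
   against the bound [C]. *)
- by move=> _ + _ _ ln; rewrite gt0_muley ?lte_fin// addey.
- by move=> _ + _ _ ln; rewrite gt0_muley ?lte_fin// addye.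
Qed.

Lemma dist0_ge0 (R : realType) (Y : normedModType R) (S : set Y) :
  0 <= dist0 S.
Proof. by apply: le_ereal_inf_tmp => _ [y _ <-]; rewrite lee_fin. Qed.

(** Triangle inequality |y| <= |y - a| + |a| for each y in S. With |a| moved to the left, it only
    remains to bound an infimum from below, which also covers empty S. *)
Lemma dist0_shift (R : realType) (Y : normedModType R) (S : set Y) (a : Y) :
  dist0 S <= dist0 [set (y - a)%R | y in S] + `|a|%:E.
Proof.
rewrite -leeBlDr//; apply: le_ereal_inf_tmp => _ [_ [y Sy <-] <-].
rewrite leeBlDr// -EFinD; apply: ge_ereal_inf; exists `|y|%:E; first by exists y.
by rewrite lee_fin -{1}(subrK a y) ler_normD.
Qed.

Lemma varphi_ge0 (R : realType) (X : Type) (Y : normedModType R)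
    (A : set X) (G : X -> set Y) (w : Y)
    (phi : \bar R -> \bar R) (omega : R -> \bar R) (x : X) (p : R) :
  (forall t, 0 <= t -> 0 <= phi t) ->
  (forall t : R, (0 <= t)%R -> 0 <= omega t) ->
  (0 <= p)%R -> 0 <= varphi A G w phi omega x p.
Proof.
move=> phi0 om0 p0; rewrite /varphi; case: ifP => _; first by case: ifP.
rewrite adde_ge0 ?om0// mule_ge0 ?lee_fin ?invr_ge0// phi0//.
by rewrite sqre_ge0.
Qed.

(** By contraposition: if e < p, then omega(e) <= omega(p), and omega(p) is at most the penalty term
    since the phi summand is nonnegative. *)
Lemma param_le_of_varphi_lt (R : realType) (X : Type) (Y : normedModType R)
    (A : set X) (G : X -> set Y) (w : Y)
    (phi : \bar R -> \bar R) (omega : R -> \bar R) (x : X) (p e : R) :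
  (forall t, 0 <= t -> 0 <= phi t) ->
  (forall s t : R, (0 <= s)%R -> (s <= t)%R -> omega s <= omega t) ->
  (0 <= p)%R -> (0 < e)%R -> varphi A G w phi omega x p < omega e ->
  (p <= e)%R.
Proof.
move=> phi0 omnd p0 e0; rewrite /varphi; case: eqP => [->|_ h].
  by rewrite ltW.
rewrite leNgt; apply/negP => /ltW ep; move: h; apply/negP; rewrite -leNgt.
apply: le_trans (omnd _ _ (ltW e0) ep) _.
by rewrite leeDr// mule_ge0 ?lee_fin ?invr_ge0// phi0// sqre_ge0.
Qed.

(** For 0 < p <= 1 the factor 1/p is at least 1, so the penalty term dominates phi(d(0, G(x) - p
    w)^2). Monotonicity of phi then forces this distance below e, and undoing the shift costs p
    |w|. *)
Lemma dist0_le_of_varphi_lt (R : realType) (X : Type) (Y : normedModType R)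
    (A : set X) (G : X -> set Y) (w : Y)
    (phi : \bar R -> \bar R) (omega : R -> \bar R) (x : X) (p e : R) :
  (forall t, 0 <= t -> 0 <= phi t) ->
  (forall t : R, (0 <= t)%R -> 0 <= omega t) ->
  (forall s t, 0 <= s -> s <= t -> phi s <= phi t) ->
  (0 <= p <= 1)%R -> (0 < e)%R -> varphi A G w phi omega x p < phi (e%:E ^+ 2) ->
  dist0 (G x) <= e%:E + (p * `|w|)%:E.
Proof.
move=> phi0 om0 phind /andP[p0 p1] e0; rewrite /varphi; case: eqP => [->|/eqP pN0 h].
  (* At p = 0 the strict bound rules out the value [+oo], so x is feasible and the distance is 0. *)
  case: ifP => [/set_mem[_ Gx0] _|_]; last by rewrite ltNge leey.
  rewrite mul0r adde0.
  apply: ge_ereal_inf; exists 0; first by exists 0%R => //; rewrite normr0.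
  by rewrite lee_fin ltW.
have pw : `|(p *: w)%R|%R = (p * `|w|)%R by rewrite normrZ ger0_norm.
apply: le_trans (dist0_shift _ _ _ (p *: w)%R) _.
rewrite pw leeD2r// leNgt; apply/negP => /ltW ed.
move: h; apply/negP; rewrite -leNgt.
set d := dist0 _ in ed *.
have e2 : 0 <= e%:E ^+ 2 by rewrite sqre_ge0.
have h : phi (e%:E ^+ 2) <= phi (d ^+ 2).
  by apply: phind => //; rewrite lee_sqr ?lee_fin ?dist0_ge0 ?(ltW e0).
apply: le_trans (leeDl _ (om0 _ p0)); apply: le_trans h _.
rewrite lee_pemull ?phi0 ?sqre_ge0// lee_fin invf_ge1// lt_neqAle eq_sym pN0.
exact: p0.
Qed.

Theorem theorem4p13 (R : realType) (X : metricType R) (Y : normedModType R)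
  (A : set X) (f : X -> \bar R) (G : X -> set Y)
  (A_neq0 : A !=set0)
  (f_neqNy : forall x, f x != -oo)
  (G_closed : forall x, closed (G x))
  (fstar : R)
  (fstar_min : exists2 x, feasible A G x &
     f x = fstar%:E /\ forall z, feasible A G z -> f x <= f z)
  (w : Y) (phi : \bar R -> \bar R) (omega : R -> \bar R)
  (phi_ge0 : forall t, 0 <= t -> 0 <= phi t)
  (phi_nd : forall s t, 0 <= s -> s <= t -> phi s <= phi t)
  (phi_eq0 : forall t, 0 <= t -> (phi t = 0 <-> t = 0))
  (omega_ge0 : forall t : R, (0 <= t)%R -> 0 <= omega t)
  (omega_nd : forall s t : R, (0 <= s)%R -> (s <= t)%R -> omega s <= omega t)
  (omega_eq0 : forall t : R, (0 <= t)%R -> (omega t = 0 <-> t = 0%R))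
  (lambda_ : nat -> R)
  (lambda_gt0 : forall n, (0 < lambda_ n)%R)
  (lambda_incr : forall m n, (m < n)%N -> (lambda_ m < lambda_ n)%R)
  (lambda_unbounded : ~ has_ubound (range lambda_))
  (x_ : nat -> X) (p_ : nat -> R)
  (xA : forall n, A (x_ n))
  (p_ge0 : forall n, (0 <= p_ n)%R)
  (eps : R) (eps_gt0 : (0 < eps)%R)
  (F := singular_penalty f A G w phi omega)
  (Fmin : forall n,
     F (lambda_ n) (x_ n) (p_ n) <= inf_penalty A F (lambda_ n) + eps%:E) :
  [/\ p_ n @[n --> \oo] --> (0%R : R),
      dist0 (G (x_ n)) @[n --> \oo] --> (0 : \bar R) &
      zero_duality_gap f A G F ->
      [/\ fstar%:E <= limn_einf (fun n => f (x_ n)),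
          limn_einf (fun n => f (x_ n)) <= limn_esup (fun n => f (x_ n)) &
          limn_esup (fun n => f (x_ n)) <= (fstar + eps)%:E]].
Proof.
have [x0 Ox0 [fx0 _]] := fstar_min.
set V := fun z : X * R => varphi A G w phi omega z.1 z.2.
set S := A `*` @nonneg_real R.
have V0 z : S z -> 0 <= V z by move=> [_ p0]; exact: varphi_ge0.
have zS n : S (x_ n, p_ n) by split; [exact: xA | exact: p_ge0].
have inf_le lam z : S z -> inf_penalty A F lam <= f z.1 + lam%:E * V z.
  by move=> Sz; apply: ereal_inf_lbound; exists z.
have inf_fstar lam : inf_penalty A F lam <= fstar%:E.
  (* The test point (x0, 0) carries no penalty, whatever [lam] is. *)
  have := inf_le lam (x0, 0%R).
  rewrite /V /varphi /= eqxx mem_set// mule0 adde0 fx0; apply; split => /=.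
    by case: Ox0.
  exact: lexx.
have upper n : f (x_ n) + (lambda_ n)%:E * V (x_ n, p_ n) <= (fstar + eps)%:E.
  by apply: le_trans (Fmin n) _; rewrite EFinD leeD2r.
have f_le n : f (x_ n) <= (fstar + eps)%:E.
  apply: le_trans (upper n); rewrite leeDl// mule_ge0 ?V0//.
  by rewrite lee_fin ltW.
have laminf := unbounded_near_ge _ _ lambda_incr lambda_unbounded.
have [m infm] : exists m : R, inf_penalty A F (lambda_ 0%N) = m%:E.
  (* The value [+oo] is excluded by f*. If the infimum were [-oo], eps-minimality at n = 0 would
     make F itself [-oo] at (x_0, p_0), although f is not [-oo] and the penalty term is
     nonnegative. *)
  move: (inf_fstar (lambda_ 0%N)) (Fmin 0%N).
  case: (inf_penalty _ _ _) => [m _ _||]; [by exists m|by []|].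
  rewrite addNye leeNy_eq adde_eq_ninfty (negbTE (f_neqNy _)) => _ /=.
  move/eqP => abs; have : 0 <= (lambda_ 0%N)%:E * V (x_ 0%N, p_ 0%N).
    by rewrite mule_ge0 ?V0// lee_fin ltW.
  by rewrite /V abs.
have Vsmall : forall e : R, (0 < e)%R ->
    \forall n \near \oo, V (x_ n, p_ n) <= e%:E.
  apply: (penalty_term_vanishes _ _ S (fun z => f z.1) V lambda_ _ m _ _ V0 lambda_gt0
    laminf _ zS upper) => [z|z Sz] //.
  by rewrite -infm; exact: inf_le.
have Vlt (c : \bar R) : 0 < c -> \forall n \near \oo, V (x_ n, p_ n) < c.
  (* The threshold [c] will be a value of [omega] or [phi], hence possibly [+oo]; for finite [c],
     halving it makes the inequality strict. *)
  case: c => [c||] // c0; last first.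
    by apply: filterS (Vsmall 1%R ltr01) => n /le_lt_trans; apply; exact: ltry.
  apply: filterS (Vsmall (c / 2)%R _) => [n /le_lt_trans|]; last exact: divr_gt0.
  by apply; move: c0; rewrite !lte_fin; lra.
have ple (e : R) : (0 < e)%R -> \forall n \near \oo, (p_ n <= e)%R.
  move=> e0; have om0 : 0 < omega e.
    rewrite lt0e omega_ge0 ?ltW// andbT; apply/eqP => /omega_eq0.
    by move=> /(_ (ltW e0)) e00; rewrite e00 ltxx in e0.
  by apply: filterS (Vlt _ om0) => n;
  apply: (param_le_of_varphi_lt _ _ _ A G w phi omega (x_ n) _ _
    phi_ge0 omega_nd (p_ge0 n) e0).
split.
- apply/cvgrPdist_le => e e0; apply: filterS (ple e e0) => n pn.
  by rewrite sub0r normrN ger0_norm.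
- apply: nneg_near_le_cvg0 => [n|e e0]; first exact: dist0_ge0.
  have e20 : (0 < e / 2)%R by rewrite divr_gt0.
  have phi_gt0 : 0 < phi ((e / 2)%:E ^+ 2).
    rewrite lt0e phi_ge0 ?sqre_ge0// andbT; apply/eqP => /phi_eq0.
    move=> /(_ (sqre_ge0 _)) /eqP; rewrite -EFin_expe eqe sqrf_eq0.
    by rewrite gt_eqF.
  have w1 : (0 < 1 + `|w|)%R by rewrite ltr_pwDl.
  near=> n.
  have pn1 : (p_ n <= 1)%R by near: n; exact: ple.
  (* This makes p_n |w| <= e/2; the denominator 1 + |w| stays positive when w = 0. *)
  have pnw : (p_ n <= e / 2 / (1 + `|w|))%R.
    by near: n; apply: ple; rewrite divr_gt0.
  apply: (@le_trans _ _ ((e / 2)%:E + (p_ n * `|w|)%:E)).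
    apply: (dist0_le_of_varphi_lt _ _ _ A _ w phi omega) => //.
      by rewrite p_ge0.
    by near: n; exact: Vlt.
  rewrite -EFinD lee_fin.
  move: pnw; rewrite ler_pdivlMr// mulrDr mulr1 => pnw.
  by have := p_ge0 n; lra.
- move=> gap; split; [|exact: limn_einf_sup|]; last first.
    by apply: limn_esup_le_near; near=> n.
  (* Since x0 attains the minimum, f* is the infimum in the duality identity. It then suffices to
     bound each inf F_lam by the limit inferior. *)
  have -> : fstar%:E =
      ereal_sup [set inf_penalty A F lam | lam in @nonneg_real R].
    rewrite gap; apply/eqP; rewrite eq_le; apply/andP; split.
      apply: le_ereal_inf_tmp => _ [z Oz <-]; rewrite -fx0.
      by case: fstar_min => x1 O1 [fx1 x1min]; rewrite fx0 -fx1; exact: x1min.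
    by rewrite -fx0; apply: ereal_inf_lbound; exists x0.
  apply: ge_ereal_sup => _ [lam lam0 <-].
  apply/lee_subgt0Pr => e e0; apply: limn_einf_ge_near.
  have l1 : (0 < 1 + lam)%R by rewrite ltr_pwDl.
  (* A penalty term below e / (1 + lam) gives lam v_n <= e, including when lam = 0. *)
  have d0 : (0 < e / (1 + lam))%R by rewrite divr_gt0.
  apply: filterS (Vsmall _ d0) => n Vn.
  rewrite leeBlDr//; apply: le_trans (inf_le lam _ (zS n)) _.
  rewrite leeD2l//; apply: le_trans (lee_wpmul2l _ Vn) _.
    by rewrite lee_fin.
  rewrite -EFinM lee_fin mulrA ler_pdivrMr//.
  by rewrite mulrC ler_pM2l//; lra.
Unshelve. all: by end_near.
Qed.
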